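(* Let $n,d\in\mathbb{N}$ with $d\mid n$, let $r,s\in\mathbb{Z}$, and let $f:\mathbb{Z}\to\mathbb{C}$ be an even function (mod $n$). Then $$\sum_{\substack{k=1\\ (k,n)=1\\ k\equiv r\ (\mathrm{mod}\ d)}}^n f(k-s)=\begin{cases}\displaystyle \frac{\varphi(n)}{\varphi(d)}\sum_{\substack{e\mid n\\ (e,s)=1\\ (e,d)\mid r-s}}\frac{(\mu*f)(e)}{\varphi(e)}\,\varphi((e,d)), & \text{if } (r,d)=1,\\[2ex] 0, & \text{if } (r,d)>1.\end{cases}$$
   Context: $\mathbb{N}$ is the set of positive integers. $(a,b)$ denotes the greatest common divisor (nonnegative, with $(0,n)=n$ for $n\in\mathbb{N}$). For fixed $n\in\mathbb{N}$, a function $f:\mathbb{Z}\to\mathbb{C}$ is called an even function (mod $n$) if $f((k,n))=f(k)$ for every $k\in\mathbb{Z}$. $\varphi$ is Euler's totient function, $\mu$ is the Möbius function, and $*$ is Dirichlet convolution of arithmetic functions, so $(\mu*f)(e)=\sum_{ab=e}\mu(a)f(b)$, the sum being over positive integers $a,b$ with $ab=e$ (here $f$ is restricted to positive integers). Sums over $e\mid n$ are over positive divisors. *)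

(* Defs.v *)
From mathcomp Require Import all_boot all_order all_algebra.
From mathcomp Require Import complex.
From mathcomp Require Import reals.

Set Implicit Arguments.
Unset Strict Implicit.
Unset Printing Implicit Defensive.

Import GRing.Theory.
Local Open Scope ring_scope.

(* Only the values at n > 0 are meaningful; moebius 0 = 0 by convention. *)
Definition moebius (n : nat) : int :=
  if (0 < n)%N && all (fun p => ~~ (p ^ 2 %| n)%N) (primes n)
  then (-1) ^+ size (primes n) else 0.

(* The pairs (a, b) of positive integers with a * b = e are the
   (a, e %/ a) for a a positive divisor of e > 0. *)
Definition dirichlet (A : pzSemiRingType) (F G : nat -> A) (e : nat) : A :=
  \sum_(a <- divisors e) F a * G (e %/ a)%N.

Definition even_mod (T : Type) (n : nat) (f : int -> T) : Prop :=
  forall k : int, f (gcdz k n%:Z) = f k.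

(* Main.v *)
(* Evenness and Moebius inversion give f(k - s) = sum of (mu * f)(e) over e
   dividing (k - s, n). Exchanging sums, it remains to count the units k mod n
   with k = r mod d and k = s mod e: they exist iff (r, d) = (s, e) = 1 and
   (d, e) | r - s, and then they form one unit class mod lcm(d, e), so there are
   phi(n) / phi(lcm(d, e)) = phi(n) phi((d, e)) / (phi(d) phi(e)) of them. *)
Require Import Defs.
From mathcomp Require Import all_boot all_order all_algebra.
From mathcomp Require Import complex.
From mathcomp Require Import reals.

From mathcomp Require Import zify ring.

Import GRing.Theory.

(** * Units modulo n in residue classes *)

Lemma eqn_modMr (u a b m : nat) : coprime m u ->
  (a * u == b * u %[mod m]) = (a == b %[mod m]).
Proof.
move=> mu; wlog le_ba : a b / b <= a.
  by move=> W; case: (leqP b a) => [/W//|/ltnW/W]; rewrite eq_sym => ->; rewrite eq_sym.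
by rewrite !eqn_mod_dvd ?leq_mul2r ?le_ba ?orbT// -mulnBl Gauss_dvdl.
Qed.

(* The witness is c + L t with t the largest divisor of n coprime to c. *)
Lemma unit_lift (n L c : nat) : 0 < n -> L %| n -> coprime c L ->
  exists2 u, coprime u n & u = c %[mod L].
Proof.
move=> n_gt0 Ln cL; pose t := \prod_(p <- primes n | ~~ (p %| c)) p.
exists (c + L * t); last by rewrite mulnC addnC modnMDl.
apply: contraT => ngt1; set p := pdiv (gcdn (c + L * t) n).
have g1 : 1 < gcdn (c + L * t) n.
  by rewrite ltn_neqAle eq_sym ngt1 gcdn_gt0 n_gt0 orbT.
have pp : prime p by rewrite pdiv_prime.
have := pdiv_dvd (gcdn (c + L * t) n); rewrite -/p dvdn_gcd => /andP[pu pn].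
have pt : (p %| t) = ~~ (p %| c).
  rewrite /t (big_morph (fun x => p %| x) (id1 := false) (op1 := orb)); first last.
  - by rewrite dvdn1; apply: contraTF pp => /eqP ->.
  - by move=> x y; rewrite Euclid_dvdM.
  rewrite big_has_cond; apply/hasP/idP => [[q]|pc]; last first.
    by exists p; rewrite ?mem_primes ?pp ?n_gt0 //= pc /=.
  rewrite mem_primes => /and3P[qp _ _] /andP[/[swap]].
  by rewrite dvdn_prime2// => /eqP ->.
(* If p divides c, it misses t, so it must divide L, against [coprime c L]. Otherwise it divides t,
   hence also c, which is absurd. *)
case: (boolP (p %| c)) pt => [pc pt|pc pt]; move: pu.
  rewrite dvdn_addr// Euclid_dvdM// pt orbF => pL.
  have : p %| gcdn c L by rewrite dvdn_gcd pc.
  by rewrite (eqP cL) dvdn1; case: eqP pp => // ->.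
by rewrite dvdn_addl ?dvdn_mull ?pt// (negbTE pc).
Qed.

(** At each prime the exponents in the gcd and the lcm are the minimum and maximum of those in a and
    b, so both sides have the same pair of local factors. *)
Lemma totient_gcd_lcm (a b : nat) : 0 < a -> 0 < b ->
  totient (gcdn a b) * totient (lcmn a b) = totient a * totient b.
Proof.
(* N exceeds a, b, their gcd and their lcm, so the four totients become products over one common
   range of primes. *)
move=> a0 b0; pose N := (a + b + a * b).+1.
(* At exponent 0 the truncated predecessor would leave a factor [p.-1], hence the guard. *)
have tE m : 0 < m -> m < N -> totient m =
    \prod_(p < N | prime p) if 0 < logn p m then p.-1 * p ^ (logn p m).-1 else 1.
  move=> m0 mN; rewrite totientE// -big_mkcondr /=.
  rewrite -(big_mkord (fun p => prime p && (0 < logn p m))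
    (fun p => p.-1 * p ^ (logn p m).-1)) -[RHS]big_filter; apply: perm_big.
  apply: uniq_perm; rewrite ?primes_uniq ?filter_uniq ?iota_uniq//.
  move=> p; rewrite mem_filter mem_index_iota /= logn_gt0.
  case: (boolP (p \in primes m)); last by rewrite andbF.
  rewrite mem_primes => /and3P[-> _ /dvdn_leq pm] /=.
  by rewrite (leq_ltn_trans (pm m0)).
have gN : gcdn a b < N.
  rewrite ltnS -addnA (leq_trans _ (leq_addr _ _))// dvdn_leq// dvdn_gcdl//.
have lN : lcmn a b < N.
  rewrite ltnS -muln_lcm_gcd (leq_trans (leq_pmulr _ _) (leq_addl _ _))//.
  by rewrite gcdn_gt0 a0.
rewrite !tE ?gcdn_gt0 ?lcmn_gt0 ?a0 ?b0 //; try by rewrite /N; lia.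
rewrite -!big_split /=; apply: eq_bigr => p _; rewrite logn_gcd// logn_lcm//.
by case: (leqP (logn p a) (logn p b)) => // _; rewrite mulnC.
Qed.

(* Multiplication by a unit mod n congruent to c mod L maps the class of 1 onto
   the class of c, so all unit classes mod L contain equally many units mod n. *)
Lemma count_units_congr (n L c : nat) : 0 < n -> L %| n -> coprime c L ->
  totient L * \sum_(k < n | coprime k n && (k == c %[mod L])) 1 = totient n.
Proof.
move=> n_gt0 Ln cL.
have L_gt0 := dvdn_gt0 n_gt0 Ln.
have cnt u : coprime u L -> \sum_(k < n | coprime k n && (k == u %[mod L])) 1 =
    \sum_(k < n | coprime k n && (k == 1 %[mod L])) 1.
  move=> uL; have [v vn <-] := unit_lift n L u n_gt0 Ln uL.
  have nv : coprime n v by rewrite coprime_sym.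
  have h_inj : injective (fun k : 'I_n => Ordinal (ltn_pmod (k * v) n_gt0)).
    move=> i j [] /eqP; rewrite eqn_modMr// !modn_small// => /eqP; exact: val_inj.
  rewrite (reindex_inj h_inj); apply: eq_bigl => k /=.
  rewrite coprime_modl coprimeMl vn andbT modn_dvdm//.
  by rewrite -{2}(mul1n v) eqn_modMr// (coprime_dvdl Ln).
rewrite [RHS]totient_count_coprime big_mkord.
transitivity (\sum_(k < n | coprime k n) 1); last first.
  rewrite [LHS]big_mkcond; apply: eq_bigr => k _.
  by rewrite coprime_sym; case: coprime.
(* Since L divides n, a unit mod n reduces to a unit mod L; this splits the units mod n into
   [totient L] classes. *)
rewrite [RHS](partition_big (fun k : 'I_n => Ordinal (ltn_pmod k L_gt0))
  (fun r : 'I_L => coprime r L)) /=; last first.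
  by move=> k kn; rewrite coprime_modl (coprime_dvdr Ln).
rewrite totient_count_coprime big_mkord big_distrl [RHS]big_mkcond.
apply: eq_bigr => r _; rewrite [coprime L r]coprime_sym.
case: (boolP (coprime r L)) => rL /=; last by [].
rewrite mul1n cnt// -(cnt r)//; apply: eq_bigl => k.
by rewrite -val_eqE /= [r %% L]modn_small.
Qed.

(** * Moebius inversion over divisors *)

Local Open Scope ring_scope.

(** A repeated prime creates a square factor; a new one adds a single prime, which flips the sign,
    and no square. *)
Lemma moebius_primeM (p a : nat) : prime p -> (0 < a)%N ->
  moebius (p * a) = if (p %| a)%N then 0 else - moebius a.
Proof.
move=> pp a0; rewrite /moebius muln_gt0 prime_gt0// a0 /=.
have [pa|pa] := boolP (p %| a)%N.
  case: allP => // /(_ p); rewrite primesM ?(prime_gt0 pp)//.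
  rewrite (primes_prime pp) inE eqxx => /(_ isT).
  by rewrite -mulnn dvdn_mul.
have pr : perm_eq (primes (p * a)) (p :: primes a).
  apply: uniq_perm; rewrite ?primes_uniq//=.
    by rewrite primes_uniq mem_primes (negbTE pa) !andbF.
  by move=> q; rewrite primesM ?(prime_gt0 pp)// (primes_prime pp) !inE.
rewrite (perm_all _ pr) (perm_size pr) /= exprS mulN1r.
have -> : (p ^ 2 %| p * a)%N = false.
  by rewrite expnS expn1 dvdn_pmul2l ?(prime_gt0 pp) ?(negbTE pa).
have -> : all (fun q => ~~ (q ^ 2 %| p * a)%N) (primes a)
        = all (fun q => ~~ (q ^ 2 %| a)%N) (primes a).
  apply: eq_in_all => q; rewrite mem_primes => /and3P[pq _ qa].
  rewrite Gauss_dvdr// coprimeXl// prime_coprime// dvdn_prime2//.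
  by apply: contraNN pa => /eqP <-.
by rewrite /=; case: ifP => // _; rewrite oppr0.
Qed.

(* With p a prime divisor of m, the term at a prime to p cancels that at p a. *)
Lemma sum_moebius (m : nat) : (1 < m)%N -> \sum_(a <- divisors m) moebius a = 0.
Proof.
move=> m1; set p := pdiv m; have pp : prime p by rewrite pdiv_prime.
have p0 := prime_gt0 pp.
have m0 : (0 < m)%N by apply: ltnW.
have pm : (p %| m)%N by rewrite pdiv_dvd.
have mp0 : (0 < m %/ p)%N by rewrite divn_gt0// dvdn_leq.
rewrite (bigID (fun a => (p %| a)%N)) /=.
rewrite -[X in X + _]big_filter.
rewrite (perm_big [seq (p * a)%N | a <- divisors (m %/ p)]) /=; last first.
  apply: uniq_perm; rewrite ?filter_uniq ?divisors_uniq//.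
    rewrite map_inj_uniq ?divisors_uniq// => x y /eqP.
    by rewrite eqn_pmul2l// => /eqP.
  move=> a; rewrite mem_filter -dvdn_divisors//; apply/andP/mapP.
    case=> /dvdnP[b ->] bm; exists b; last by rewrite mulnC.
    by rewrite -dvdn_divisors// dvdn_divRL.
  case=> b; rewrite -dvdn_divisors// dvdn_divRL// => bm ->.
  by rewrite dvdn_mulr// mulnC.
rewrite big_map big_seq_cond.
under eq_bigr => a.
  rewrite andbT -dvdn_divisors// => /(dvdn_gt0 mp0) a0.
  rewrite moebius_primeM// -if_neg; over.
rewrite -big_mkcondr sumrN; apply/eqP; rewrite addrC subr_eq0; apply/eqP.
rewrite -big_filter -[RHS]big_filter; apply: perm_big.
apply: uniq_perm; rewrite ?filter_uniq ?divisors_uniq//.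
move=> a; rewrite !mem_filter -!dvdn_divisors//; case: (boolP (p %| a)%N) => pa /=.
  by rewrite andbF.
(* A number prime to p divides m = (m / p) p iff it divides m / p. *)
by rewrite !andbT andbb -[in LHS](divnK pm) Gauss_dvdl// coprime_sym prime_coprime.
Qed.

(** After exchanging sums, the coefficient of [f b] is the sum of [moebius] over the divisors of m /
    b, which vanishes unless b = m. *)
Lemma dirichlet_moebiusK (A : pzRingType) (f : nat -> A) (m : nat) : (0 < m)%N ->
  \sum_(e <- divisors m) dirichlet (fun a => (moebius a)%:~R) f e = f m.
Proof.
move=> m0.
have dvd1 e : e \in divisors m -> (0 < e)%N.
  by rewrite -dvdn_divisors//; apply: dvdn_gt0.
(* Passing to the complementary divisor b = e / a makes the argument of f the summation index, ready
   for the exchange. *)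
transitivity (\sum_(e <- divisors m)
    \sum_(b <- divisors m | (b %| e)%N) (moebius (e %/ b))%:~R * f b).
  apply: eq_big_seq => e em; have e0 := dvd1 e em.
  rewrite /dirichlet -[RHS]big_filter.
  rewrite [RHS](perm_big [seq (e %/ a)%N | a <- divisors e]) /=.
    rewrite big_map; apply: eq_big_seq => a; rewrite -dvdn_divisors// => ae.
    by rewrite divnA// mulKn.
  apply: uniq_perm; rewrite ?filter_uniq ?divisors_uniq//.
    rewrite map_inj_in_uniq ?divisors_uniq// => x y.
    rewrite -!dvdn_divisors// => xe ye /(congr1 (fun z => e %/ z)%N).
    by rewrite !divnA// !mulKn.
  move=> b; rewrite mem_filter -dvdn_divisors//; apply/andP/mapP.
    case=> be _; exists (e %/ b)%N; last by rewrite divnA// mulKn.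
    by rewrite -dvdn_divisors// dvdn_div.
  case=> a; rewrite -dvdn_divisors// => ae ->; rewrite dvdn_div//.
  split=> //; by apply: dvdn_trans (dvdn_div ae) _; rewrite dvdn_divisors.
rewrite (exchange_big_dep predT)//=.
transitivity (\sum_(b <- divisors m)
    (\sum_(a <- divisors (m %/ b)) moebius a)%:~R * f b).
  apply: eq_big_seq => b bm; have b0 := dvd1 b bm.
  have {bm} bm : (b %| m)%N by rewrite dvdn_divisors.
  have mb0 : (0 < m %/ b)%N by rewrite divn_gt0// dvdn_leq.
  rewrite rmorph_sum big_distrl /= -big_filter.
  rewrite (perm_big [seq (b * a)%N | a <- divisors (m %/ b)]) /=; last first.
    apply: uniq_perm; rewrite ?filter_uniq ?divisors_uniq//.
      rewrite map_inj_uniq ?divisors_uniq// => x y /eqP.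
      by rewrite eqn_pmul2l// => /eqP.
    move=> e; rewrite mem_filter -dvdn_divisors//; apply/andP/mapP.
      case=> /dvdnP[c ->] cm; exists c; last by rewrite mulnC.
      by rewrite -dvdn_divisors// dvdn_divRL.
    case=> c; rewrite -dvdn_divisors// dvdn_divRL// => cm ->.
    by rewrite dvdn_mulr// mulnC.
  by rewrite big_map; apply: eq_bigr => a _; rewrite mulKn.
rewrite (bigD1_seq m) ?divisors_uniq ?divisors_id//= divnn m0.
rewrite big_cons big_nil addr0 mul1r big_seq_cond big1 ?addr0// => b /andP[].
rewrite -dvdn_divisors// => bm bNm.
rewrite sum_moebius ?mul0r// ltn_divRL// mul1n ltn_neqAle bNm.
exact: dvdn_leq.
Qed.

(** * Units satisfying two congruences *)

Lemma crt_noncoprime (d e r s : int) : (gcdz e d %| r - s)%Z ->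
  exists2 x : int, (d %| x - r)%Z & (e %| x - s)%Z.
Proof.
case: (Bezoutz e d) => u [v <-] /dvdzP[q rs].
(* Since r - s = q (u e + v d), this witness is also r - q v d. *)
exists (s + q * u * e); last by rewrite addrC addKr dvdz_mull.
have -> : s + q * u * e - r = - (q * v) * d by lia.
exact: dvdz_mull.
Qed.

Lemma eqmodz_gcd (d x y : int) : (d %| x - y)%Z -> gcdz x d = gcdz y d.
Proof.
move=> /dvdzP[q /eqP]; rewrite subr_eq => /eqP ->.
by rewrite ![gcdz _ d]gcdzC gcdzMDl.
Qed.

(** The totients of d and e are multiplied out so that the count stays in [nat]. A solution k forces
    all three conditions; under them the two congruences merge into one modulo the lcm. *)
Lemma count_units_congr2 (n d e : nat) (r s : int) :
    (0 < n)%N -> (d %| n)%N -> (e %| n)%N ->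
  (totient d * totient e *
   \sum_(k < n | [&& coprime k n, (d %| (k%:Z - r)%R)%Z & (e %| (k%:Z - s)%R)%Z]) 1)%N
  = if [&& gcdz r d == 1, gcdz e s == 1 & (gcdn e d %| r - s)%Z]
    then (totient n * totient (gcdn e d))%N else 0%N.
Proof.
move=> n0 dn en; have d0 := dvdn_gt0 n0 dn; have e0 := dvdn_gt0 n0 en.
case: ifPn => [/and3P[rd es ders]|Ncond]; last first.
  rewrite big_pred0 ?muln0// => k; apply: contraNF Ncond => /and3P[kn kr ks].
  rewrite -(eqmodz_gcd _ _ _ kr) [gcdz e s]gcdzC -(eqmodz_gcd _ _ _ ks).
  rewrite -!/(coprimez _ _) !coprimezE /= (coprime_dvdr dn kn) (coprime_dvdr en kn) /=.
  have -> : r - s = (k%:Z - s) - (k%:Z - r) by lia.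
  apply: rpredB.
    by apply: dvdz_trans ks; rewrite dvdzE /= dvdn_gcdl.
  by apply: dvdz_trans kr; rewrite dvdzE /= dvdn_gcdr.
have [x xr xs] := crt_noncoprime d e r s ders.
pose L := lcmn d e; have L0 : (0 < L)%N by rewrite lcmn_gt0 d0.
have [c cx] : exists c : nat, (L %| c%:Z - x)%Z.
  exists `|(x %% L)%Z|%N; rewrite gez0_abs ?modz_ge0 -?eqz_mod_dvd ?modz_mod//; lia.
have dx k : (d %| k - r)%Z = (d %| k - x)%Z.
  have -> : k - r = (k - x) + (x - r) by lia.
  by rewrite rpredDr.
have ex k : (e %| k - s)%Z = (e %| k - x)%Z.
  have -> : k - s = (k - x) + (x - s) by lia.
  by rewrite rpredDr.
have cd : (d %| c%:Z - r)%Z.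
  by rewrite dx; apply: dvdz_trans cx; rewrite dvdzE /= dvdn_lcml.
have ce : (e %| c%:Z - s)%Z.
  by rewrite ex; apply: dvdz_trans cx; rewrite dvdzE /= dvdn_lcmr.
(* L divides d e, and c inherits coprimality to d from r and to e from s. *)
have cL : coprime c L.
  apply: (@coprime_dvdr _ (d * e)).
    by rewrite dvdn_lcm dvdn_mulr ?dvdn_mull.
  rewrite coprimeMr; apply/andP; split.
    by rewrite -(coprimezE c d) /coprimez (eqmodz_gcd _ _ _ cd).
  by rewrite -(coprimezE c e) /coprimez (eqmodz_gcd _ _ _ ce) gcdzC.
have Ln : (L %| n)%N by rewrite dvdn_lcm dn.
rewrite -totient_gcd_lcm// gcdnC -mulnA mulnC; congr (_ * _)%N.
rewrite -(count_units_congr n L c)//; congr (_ * _)%N.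
apply: eq_bigl => k; congr (_ && _); rewrite dx ex.
rewrite -[LHS]/((d %| `|k%:Z - x|)%N && (e %| `|k%:Z - x|)%N) -dvdn_lcm.
rewrite -/L -[LHS]/(L %| k%:Z - x)%Z.
have -> : k%:Z - x = (k%:Z - c%:Z) + (c%:Z - x) by lia.
by rewrite rpredDr// -eqz_mod_dvd !modz_nat.
Qed.


(** * Even functions and the restricted sum over units *)

Lemma even_mod_sum (A : pzRingType) (n : nat) (f : int -> A) (x : int) :
    (0 < n)%N -> even_mod n f ->
  f x = \sum_(e <- divisors n | (e %| x)%Z)
          dirichlet (fun a => (moebius a)%:~R) (fun b => f b%:Z) e.
Proof.
(* Evenness replaces x by (x, n), where Moebius inversion applies; the divisors of (x, n) are those
   of n that divide x. *)
move=> n0 f_even; rewrite -f_even /gcdz /=.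
have g0 : (0 < gcdn `|x| n)%N by rewrite gcdn_gt0 n0 orbT.
rewrite -(dirichlet_moebiusK A (fun b => f b%:Z))// -[RHS]big_filter.
apply: perm_big; apply: uniq_perm; rewrite ?filter_uniq ?divisors_uniq// => e.
by rewrite mem_filter -!dvdn_divisors// dvdn_gcd.
Qed.

Local Open Scope complex_scope.

Theorem theorem2p1 (R : realType) (n d : nat) (n_gt0 : (0 < n)%N)
    (d_gt0 : (0 < d)%N) (d_dvd_n : (d %| n)%N) (r s : int) (f : int -> R[i])
    (f_even : even_mod n f) :
  \sum_(1 <= k < n.+1 | coprime k n && (k%:Z == r %[mod d%:Z])%Z)
      f (k%:Z - s)
  = if gcdz r d%:Z == 1
    then (totient n)%:R / (totient d)%:R *
         \sum_(e <- divisors n |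
                 (gcdz e%:Z s == 1) && ((gcdn e d)%:Z %| r - s)%Z)
            dirichlet (fun a => (moebius a)%:~R) (fun b => f b%:Z) e
            / (totient e)%:R * (totient (gcdn e d))%:R
    else 0.
Proof.
set g := dirichlet _ _.
(* The term k = n is traded for k = 0: both satisfy the same conditions because d divides n, and f(n
   - s) = f(-s) by evenness. *)
have -> :
    \sum_(1 <= k < n.+1 | coprime k n && (k%:Z == r %[mod d%:Z])%Z) f (k%:Z - s)
    = \sum_(k < n | coprime k n && (d %| k%:Z - r)%Z) f (k%:Z - s).
  rewrite -(big_mkord (fun k => coprime k n && (d %| k%:Z - r)%Z)
    (fun k => f (k%:Z - s))) big_mkcond [RHS]big_mkcond.
  rewrite big_nat_recr//= [RHS]big_ltn// addrC; congr (_ + _); last first.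
    by apply: eq_bigr => k _; rewrite eqz_mod_dvd.
  rewrite eqz_mod_dvd /coprime gcdnn gcd0n; congr (if _ && _ then _ else _).
    have -> : n%:Z - r = n%:Z + (0%:Z - r) by lia.
    by rewrite rpredDl.
  rewrite -[LHS]f_even -[RHS]f_even; congr f.
  by rewrite ![gcdz _ n]gcdzC sub0r gcdzDl.
under eq_bigr => k _ do rewrite (even_mod_sum _ _ _ _ n_gt0 f_even) -/g.
rewrite (exchange_big_dep predT)//=.
have tne m : (0 < m)%N -> (totient m)%:R != 0 :> R[i].
  by move=> m0; rewrite Num.Theory.pnatr_eq0 -lt0n totient_gt0.
have term e : e \in divisors n ->
    \sum_(k < n | coprime k n && (d %| k%:Z - r)%Z && (e %| k%:Z - s)%Z) g e =
    if [&& gcdz r d == 1, gcdz e s == 1 & (gcdn e d %| r - s)%Z]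
    then (totient n)%:R / (totient d)%:R *
         (g e / (totient e)%:R * (totient (gcdn e d))%:R)
    else 0.
  rewrite -dvdn_divisors// => en; have e0 := dvdn_gt0 n_gt0 en.
  have := count_units_congr2 n d e r s n_gt0 d_dvd_n en.
  set N := (\sum_(k < n | _) _)%N => /(congr1 (fun x => x%:R : R[i])).
  have -> : \sum_(k < n | coprime k n && (d %| k%:Z - r)%Z
      && (e %| k%:Z - s)%Z) g e = g e * N%:R.
    by rewrite natr_sum mulr_sumr; apply: eq_big => k; rewrite ?mulr1 ?andbA.
  rewrite !natrM => NE.
  (* Multiplying by the totients of d and e, nonzero in [R[i]], brings in the product form of the
     count. *)
  apply: (mulfI (mulf_neq0 (tne d d_gt0) (tne e e0))).
  rewrite mulrCA NE; case: ifP => _; last by rewrite !mulr0.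
  rewrite natrM; field; by rewrite !tne.
rewrite (eq_big_seq _ term); case: eqP => _ /=; last by rewrite big1.
by rewrite -big_mkcond/= mulr_sumr.
Qed.
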